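(* Let $(D,S,F)$ be a POA signature, and let $q\colon B\to B'$ and $h\colon B'\to N$ be homomorphisms of $(D\cup S,F)$-algebras such that $\beta=h\circ q\colon B\to N$ is an nf-homomorphism. Let $\Gamma$ be a $\beta$-coherent set of $(D,S,F)$-transitions that in addition satisfies the following conditions: (i) for each transition $\forall X\,H\to(t\Rightarrow t')$ in $\Gamma$, $H$ is a finite conjunction of equations of the form $t_i=c_i$ where $c_i$ is a constant (of $F$) such that $B_{c_i}\in N$; (ii) for each sort $s$ of an equation $t_i=c_i$ that occurs in a condition of a transition in $\Gamma$: (no junk) for each $b\in B_s$ there is a constant $c\in F_{\to s}$ such that $B_c\in N$ and $b=B_c$; (no confusion) $B_c\neq B_{c'}$ for any two distinct constants $c,c'\in F_{\to s}$ such that $B_c,B_{c'}\in N$. Then $h\colon(B',\stackrel{*}{\longrightarrow}_{\Gamma/B'})\to(N,\stackrel{*}{\longrightarrow}_{\Gamma/\beta})$ is a POA homomorphism.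
   Context: POA signatures. A POA signature is a triple $(D,S,F)$ with $D\cap S=\emptyset$ and $(D\cup S,F)$ a many-sorted algebraic signature (operation symbols $\sigma\in F_{w\to s}$, with arity $w$ and sort $s$; $F_{\to s}$ is the set of constants of sort $s$); elements of $D$ are data sorts, elements of $S$ are system sorts. Terms and variables are those of $(D\cup S,F)$. Atoms are equations $t=t'$ between terms of the same sort, and transitions $t\Rightarrow t'$ between terms of the same system sort. A $(D,S,F)$-transition is a Horn sentence $\forall X\, H\to (t\Rightarrow t')$, where $X$ is a set of variables, $H$ is a finite conjunction of atoms (equations and/or transitions), and the atoms are over $(D\cup S,F\cup X)$. $H_=$ is the set of equations and $H_\to$ the set of transitions in $H$, viewed as sets of pairs of terms. Preordered algebras. A preordered $(D,S,F)$-algebra $(A,\leqslant)$ is a $(D\cup S,F)$-algebra $A$ with a preorder $\leqslant_s$ on $A_s$ for each $s\in S$, such that $A_\sigma$ is monotone for each operation symbol $\sigma$ whose result sort is a system sort (arguments of data sorts being compared by equality). A POA homomorphism is a homomorphism of the underlying algebras that is monotone on system sorts. For a sort-respecting map $\theta\colon X\to A$ and a term $t$ over $F\cup X$, $\theta t$ is the value of $t$ in $A$ under $\theta$. Algebraic rewriting. A context $c[z]$ is a term $c$ over $(D\cup S,F\cup\{z\})$, where $z$ is a new variable, such that either $c=z$, or $c=\sigma(c_1,\dots,c_n)$ with $\sigma$ an operation symbol of $F$ and exactly one $k\in\{1,\dots,n\}$ such that $c_k$ is a context, the other $c_i$ ($i\neq k$) being just $(D\cup S,F)$-terms. Let $B$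 be a $(D\cup S,F)$-algebra. For a context $c[z]$ of sort $s'$ with $z$ of sort $s$, $B_c\colon B_s\to B_{s'}$ is the identity if $c=z$, and $B_c(b)=B_\sigma(B_{c_1},\dots,B_{c_k}(b),\dots,B_{c_n})$ if $c=\sigma(c_1,\dots,c_k[z],\dots,c_n)$. Let $\Delta_B=\{(b,b)\mid b\in B\}$ be the diagonal, and for a relation $\Omega\subseteq B\times B$ let $$\Gamma(\Omega)=\{(B_c(\theta t),B_c(\theta t'))\mid c[z]\text{ a context whose sort is a system sort, with } z \text{ of the sort of } t,t',\ (\forall X\,H\to(t\Rightarrow t'))\in\Gamma,\ \theta\colon X\to B,\ \theta H_=\subseteq\Delta_B,\ \theta H_\to\subseteq\Omega\}.$$ Put $\Gamma_{B,0}=\Delta_B$, $\Gamma_{B,k+1}=\Gamma_{B,k}^*\cup\Gamma(\Gamma_{B,k}^* )$, where $R^*$ is the reflexive-transitive closure of $R$. Define $b\longrightarrow_{\Gamma/B}b'$ iff $(b,b')\in\Gamma(\Gamma_{B,k}^* )$ for some $k\in\omega$, and let $\stackrel{*}{\longrightarrow}_{\Gamma/B}$ be the reflexive-transitive closure of $\longrightarrow_{\Gamma/B}$ (on data sorts it is equality; in preordered algebras one uses its restriction to system sorts). The same definitions apply to $B'$ in place of $B$. Normal forms and coherence. A homomorphism $\beta\colon B\to N$ of $(D\cup S,F)$-algebras is an nf-homomorphism when $N\subseteq B$ (inclusion of carriers, sort by sort) and $\beta n=n$ for each $n\in N$. The relation $\longrightarrow_{\Gamma/\beta}$ on $N$ is: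 $n_1\longrightarrow_{\Gamma/\beta}n_2$ iff there is $b_2\in B$ with $n_1\longrightarrow_{\Gamma/B}b_2$ and $\beta b_2=n_2$; $\stackrel{*}{\longrightarrow}_{\Gamma/\beta}$ is its reflexive-transitive closure. $\Gamma$ is $\beta$-coherent when $b_1\longrightarrow_{\Gamma/B}b_2$ implies $\beta b_1\stackrel{*}{\longrightarrow}_{\Gamma/\beta}\beta b_2$.
   Formalization: The formal result says h is an algebra homomorphism, monotone on system sorts for the two preorders; it does not claim that operations of B' and N are monotone for them, which can fail since contexts have only ground terms beside the hole. *)

(* Defs.v *)
From Stdlib Require Export List Relations.
Export ListNotations.

Set Implicit Arguments.
Unset Strict Implicit.

(* The sorts are the disjoint sum of data and system sorts; [op w s] is the
   set F_{w -> s}, so symbols may be overloaded across ranks. *)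
Record poa_signature := {
  data : Type;
  sys : Type;
  op : list (data + sys) -> data + sys -> Type }.

Definition sort (Sg : poa_signature) : Type := (data Sg + sys Sg)%type.

Definition ssort {Sg : poa_signature} (s : sys Sg) : sort Sg := inr s.

(* Tuples (x_1, ..., x_n) with x_i in T s_i, for w = s_1 ... s_n. *)
Inductive args {I : Type} (T : I -> Type) : list I -> Type :=
| anil : args T []
| acons : forall s w, T s -> args T w -> args T (s :: w).

Arguments anil {I T}.
Arguments acons {I T s w} _ _.

Section Args.
Context {I : Type} {T T' : I -> Type}.

Definition amap (g : forall s, T s -> T' s) : forall w, args T w -> args T' w :=
  fix amap w (a : args T w) : args T' w :=
    match a with
    | anil => anil
    | acons x a => acons (g _ x) (amap _ a)
    end.

Fixpoint aapp {w1 w2} (a1 : args T w1) (a2 : args T w2) : args T (w1 ++ w2) :=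
  match a1 in args _ w return args T (w ++ w2) with
  | anil => a2
  | acons x a => acons x (aapp a a2)
  end.
End Args.

Section Algebra.
Variable Sg : poa_signature.

Record algebra := {
  carrier :> sort Sg -> Type;
  interp : forall w s, op w s -> args carrier w -> carrier s }.

Inductive term (X : sort Sg -> Type) : sort Sg -> Type :=
| Var : forall s, X s -> term X s
| App : forall w s, op w s -> args (term X) w -> term X s.

Definition cst_term (X : sort Sg -> Type) (s : sort Sg) (c : op [] s) : term X s :=
  App c anil.

Definition cst (A : algebra) (s : sort Sg) (c : op [] s) : A s := interp c anil.

Fixpoint eval (A : algebra) (X : sort Sg -> Type) (theta : forall s, X s -> A s)
    (s : sort Sg) (t : term X s) : A s :=
  match t with
  | Var x => theta _ x
  | App f ts => interp f (amap (eval theta) ts)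
  end.

Definition ground (s : sort Sg) : Type := term (fun _ => Empty_set) s.

Definition geval (A : algebra) (s : sort Sg) (t : ground s) : A s :=
  eval (fun _ (x : Empty_set) => match x with end) t.

(* [ctx s s'] is the type of contexts c[z] of sort s' with z of sort s.  The
   siblings of the subterm containing z are terms over F alone, hence ground. *)
Inductive ctx (s : sort Sg) : sort Sg -> Type :=
| Hole : ctx s s
| CApp : forall w1 s1 w2 s', op (w1 ++ s1 :: w2) s' ->
    args ground w1 -> ctx s s1 -> args ground w2 -> ctx s s'.

Fixpoint ctx_eval (A : algebra) (s s' : sort Sg) (c : ctx s s') (b : A s) : A s' :=
  match c in ctx _ u return A u with
  | Hole _ => b
  | CApp f l c r =>
      interp f (aapp (amap (@geval A) l)
                     (acons (ctx_eval c b) (amap (@geval A) r)))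
  end.

Inductive atom (X : sort Sg -> Type) : Type :=
| Eqn : forall s : sort Sg, term X s -> term X s -> atom X
| Trans : forall s : sys Sg, term X (ssort s) -> term X (ssort s) -> atom X.

(* The Horn sentence  forall tr_vars, tr_cond -> (tr_lhs => tr_rhs). *)
Record transition := {
  tr_vars : sort Sg -> Type;
  tr_cond : list (atom tr_vars);
  tr_sort : sys Sg;
  tr_lhs : term tr_vars (ssort tr_sort);
  tr_rhs : term tr_vars (ssort tr_sort) }.

Definition srel (A : algebra) : Type := forall s, relation (A s).

Definition star (A : algebra) (R : srel A) : srel A :=
  fun s => clos_refl_trans (A s) (R s).

Global Arguments star {A} R s _ _.

Section Rewriting.
Variables (Gamma : transition -> Prop) (B : algebra).

(* The relation Gamma(Omega); it relates elements of system sorts only. *)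
Inductive rew_step (Omega : srel B) : srel B :=
| RewStep : forall (tr : transition) (s' : sys Sg)
      (c : ctx (ssort (tr_sort tr)) (ssort s'))
      (theta : forall s, tr_vars tr s -> B s),
    Gamma tr ->
    (forall s (t t' : term (tr_vars tr) s),
        In (Eqn t t') (tr_cond tr) -> eval theta t = eval theta t') ->
    (forall s (t t' : term (tr_vars tr) (ssort s)),
        In (Trans t t') (tr_cond tr) ->
        Omega (ssort s) (eval theta t) (eval theta t')) ->
    rew_step Omega
      (ctx_eval c (eval theta (tr_lhs tr))) (ctx_eval c (eval theta (tr_rhs tr))).

Global Arguments rew_step Omega s _ _ : clear implicits.

Fixpoint rew_level (k : nat) : srel B :=
  match k with
  | 0 => fun s => @eq (B s)
  | S k => fun s => union (B s) (star (rew_level k) s)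
                          (rew_step (star (rew_level k)) s)
  end.

Definition rew : srel B :=
  fun s b b' => exists k, rew_step (star (rew_level k)) s b b'.
End Rewriting.

Definition is_hom (A A' : algebra) (f : forall s, A s -> A' s) : Prop :=
  forall w s (o : op w s) (a : args A w), f s (interp o a) = interp o (amap f a).

(* Being a POA homomorphism, for preorders le and le' on the system sorts.
   Monotonicity of the operations with respect to le and le' is not part of it:
   for the rewriting preorders it can fail at operations with several arguments,
   since the siblings in a context are ground and need not denote all elements. *)
Definition is_poa_hom (A A' : algebra)
    (le : forall s : sys Sg, relation (A (ssort s)))
    (le' : forall s : sys Sg, relation (A' (ssort s)))
    (f : forall s, A s -> A' s) : Prop :=
  (forall s : sys Sg, preorder (A (ssort s)) (le s)) /\
  (forall s : sys Sg, preorder (A' (ssort s)) (le' s)) /\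
  is_hom f /\
  (forall (s : sys Sg) (x y : A (ssort s)), le s x y -> le' s (f _ x) (f _ y)).

Definition on_sys (A : algebra) (R : srel A) (s : sys Sg) : relation (A (ssort s)) :=
  R (ssort s).

Global Arguments on_sys {A} R s _ _.

(* The inclusion of carriers of N into B is given by the injections incl. *)
Definition nf_hom (B N : algebra) (incl : forall s, N s -> B s)
    (beta : forall s, B s -> N s) : Prop :=
  (forall s (n n' : N s), incl s n = incl s n' -> n = n') /\
  is_hom beta /\
  (forall s (n : N s), beta s (incl s n) = n).

Definition in_nf (B N : algebra) (incl : forall s, N s -> B s) (s : sort Sg)
    (b : B s) : Prop :=
  exists n : N s, incl s n = b.

Definition rew_nf (Gamma : transition -> Prop) (B N : algebra)
    (incl : forall s, N s -> B s) (beta : forall s, B s -> N s) : srel N :=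
  fun s n1 n2 =>
    exists b2 : B s, rew Gamma (s := s) (incl s n1) b2 /\ beta s b2 = n2.

Definition coherent (Gamma : transition -> Prop) (B N : algebra)
    (incl : forall s, N s -> B s) (beta : forall s, B s -> N s) : Prop :=
  forall s (b1 b2 : B s), rew Gamma b1 b2 ->
    star (rew_nf Gamma incl beta) s (beta s b1) (beta s b2).

Definition constant_conditions (Gamma : transition -> Prop) (B N : algebra)
    (incl : forall s, N s -> B s) : Prop :=
  forall tr, Gamma tr -> forall a, In a (tr_cond tr) ->
    exists (s : sort Sg) (t : term (tr_vars tr) s) (c : op [] s),
      a = Eqn t (cst_term _ c) /\ in_nf incl (cst B c).

Definition condition_sort (Gamma : transition -> Prop) (s : sort Sg) : Prop :=
  exists tr, Gamma tr /\
    exists t t' : term (tr_vars tr) s, In (Eqn t t') (tr_cond tr).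

Definition no_junk (B N : algebra) (incl : forall s, N s -> B s) (s : sort Sg) : Prop :=
  forall b : B s, exists c : op [] s, in_nf incl (cst B c) /\ b = cst B c.

Definition no_confusion (B N : algebra) (incl : forall s, N s -> B s)
    (s : sort Sg) : Prop :=
  forall c c' : op [] s, c <> c' ->
    in_nf incl (cst B c) -> in_nf incl (cst B c') -> cst B c <> cst B c'.
End Algebra.

(* Main.v *)
Require Import Defs.

(** A rewrite step in [B'] uses a context [c] over ground terms, a transition
    [H -> (t => t')] and a valuation [theta'] in [B'].  Both [h] and [beta] are
    homomorphisms into [N], and the value of a context or of a term is preserved
    by homomorphisms ([hom_eval], [hom_ctx_eval]).  Take the valuation
    [theta x = incl (h (theta' x))] in [B]: composed with [beta] it gives
    [h o theta'], because [beta] fixes normal forms.  If [theta] satisfies [H],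
    then the same context and transition give a rewrite step in [B] that [beta]
    sends to the pair of [h]-images of the given step ([rew_lift]), and coherence
    turns it into a chain of normal-form rewrites.

    So everything rests on [theta] satisfying [H].  A condition [t_i = c_i] holds
    under [theta'] in [B'], hence the two sides get the same image under [beta]
    in [N].  They are then equal already in [B]: by the absence of junk the value
    of [t_i] is a constant lying in [N], the value of [c_i] lies in [N] as well,
    and [beta] is injective on [N] ([nf_inj]).  Since all conditions are
    equations, no hypothesis on earlier rewrite levels has to be transported. *)

(** * Homomorphisms preserve the values of terms and contexts *)

Lemma amap_aapp {I : Type} {T T' : I -> Type} (g : forall s, T s -> T' s)
    {w1 w2} (a1 : args T w1) (a2 : args T w2) :
  amap g (aapp a1 a2) = aapp (amap g a1) (amap g a2).
Proof. induction a1; simpl; congruence. Qed.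

Lemma amap_comp {I : Type} {T T' T'' : I -> Type} (g : forall s, T s -> T' s)
    (g' : forall s, T' s -> T'' s) {w} (a : args T w) :
  amap g' (amap g a) = amap (fun s x => g' s (g s x)) a.
Proof. induction a; simpl; congruence. Qed.

Section Hom.
Context {Sg : poa_signature} {A A' : algebra Sg} {f : forall s, A s -> A' s}.
Hypothesis hf : is_hom f.

(** The valuations are related pointwise, instead of taking [f o theta] for
    [theta'], so that [theta'] can be given independently; this covers in
    particular the empty valuations of ground terms. *)
Lemma hom_eval {X : sort Sg -> Type} {theta : forall s, X s -> A s}
    {theta' : forall s, X s -> A' s} :
  (forall s x, f s (theta s x) = theta' s x) ->
  forall s (t : term X s), f s (eval theta t) = eval theta' t.
Proof.
  intros htheta.
  (* The automatic induction principle of [term] gives no hypothesis for the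
     arguments of an operation, which are nested in [args]. *)
  fix IH 2; intros s [s0 x | w s0 o ts]; simpl.
  - apply htheta.
  - rewrite hf; f_equal; rewrite amap_comp.
    (* [o] is dropped because its type mentions the arity, on which the
       induction over the arguments proceeds. *)
    clear o.
    induction ts as [| s1 w t ts IHts]; simpl; f_equal; auto.
Qed.

Lemma hom_ageval {w} (a : args (@ground Sg) w) :
  amap f (amap (@geval Sg A) a) = amap (@geval Sg A') a.
Proof.
  rewrite amap_comp.
  induction a; simpl; f_equal; auto.
  apply hom_eval; intros ? [].
Qed.

Lemma hom_ctx_eval {s s'} (c : ctx s s') (b : A s) :
  f s' (ctx_eval c b) = ctx_eval c (f s b).
Proof.
  induction c as [| w1 s1 w2 s' o l c IH r]; simpl; auto.
  rewrite hf, amap_aapp; simpl.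
  now rewrite !hom_ageval, IH.
Qed.
End Hom.

(** * Lifting rewrite steps *)

Section Lift.
Context {Sg : poa_signature} {B B' N : algebra Sg}
  {h : forall s, B' s -> N s} {incl : forall s, N s -> B s}
  {beta : forall s, B s -> N s}.
Hypothesis hh : is_hom h.
Hypothesis hbeta : nf_hom incl beta.

Lemma nf_inj {s} (b1 b2 : B s) :
  in_nf incl b1 -> in_nf incl b2 -> beta s b1 = beta s b2 -> b1 = b2.
Proof.
  destruct hbeta as (_ & _ & hfix).
  intros [n1 <-] [n2 <-]; rewrite !hfix; congruence.
Qed.

(** Satisfaction of an equational atom.  Being a function of the atom, it can be
    transported along an equation between atoms, without inverting the dependent
    constructor [Eqn].  Transition atoms count as failing, so that satisfaction
    also records that a condition contains none. *)
Definition eqn_holds {A : algebra Sg} {X : sort Sg -> Type}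
    (theta : forall s, X s -> A s) (a : atom X) : Prop :=
  match a with
  | Eqn t t' => eval theta t = eval theta t'
  | Trans _ _ => False
  end.

Variable Gamma : transition Sg -> Prop.
Hypothesis hcond : constant_conditions Gamma incl.
Hypothesis hjunk : forall s, condition_sort Gamma s -> no_junk incl s.

(** In [B], both sides of a condition have values in [N], the right one by the
    shape of the conditions and the left one because there is no junk; so it is
    enough to compare their [beta]-images. *)
Lemma condition_lift {tr} {theta : forall s, tr_vars tr s -> B s}
    {theta' : forall s, tr_vars tr s -> B' s} :
  Gamma tr ->
  (forall s x, beta s (theta s x) = h s (theta' s x)) ->
  (forall s (t t' : term (tr_vars tr) s),
     In (Eqn t t') (tr_cond tr) -> eval theta' t = eval theta' t') ->
  forall a, In a (tr_cond tr) -> eqn_holds theta a.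
Proof.
  intros hG htheta hsat a ha.
  pose proof hbeta as (_ & hb & _).
  destruct (hcond _ hG _ ha) as (s & t & c & -> & hc); simpl.
  apply nf_inj.
  - assert (hs : condition_sort Gamma s) by (exists tr; eauto).
    destruct (hjunk _ hs (eval theta t)) as (d & hd & ->); exact hd.
  - exact hc.
  - pose (thetaN s x := h s (theta' s x)).
    rewrite (hom_eval (theta' := thetaN) hb htheta _ t).
    rewrite <- (hom_eval (theta' := thetaN) hh (fun s x => eq_refl) _ t).
    rewrite (hsat _ _ _ ha); simpl.
    now rewrite hh, hb.
Qed.

(** The two steps are compared through their images in [N] only, since coherence
    speaks of the [beta]-images of the endpoints of a step in [B].  Evaluating in
    [B] the normal forms of the values of [theta'] then gives a suitable step. *)
Lemma rew_lift {s} {b1 b2 : B' s} :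
  rew Gamma b1 b2 ->
  exists a1 a2 : B s,
    rew Gamma a1 a2 /\ beta s a1 = h s b1 /\ beta s a2 = h s b2.
Proof.
  intros [k hstep]; destruct hstep as [tr s' c theta' hG heq _].
  pose proof hbeta as (_ & hb & hfix).
  pose (thetaN s x := h s (theta' s x)).
  pose (theta s x := incl s (thetaN s x)).
  assert (htheta : forall s x, beta s (theta s x) = thetaN s x)
    by (intros; apply hfix).
  pose proof (condition_lift hG htheta heq) as hsat.
  assert (himage : forall t : term (tr_vars tr) (ssort (tr_sort tr)),
            beta _ (ctx_eval c (eval theta t)) = h _ (ctx_eval c (eval theta' t))).
  { intros t.
    rewrite (hom_ctx_eval hb), (hom_ctx_eval hh); f_equal.
    rewrite (hom_eval (theta' := thetaN) hb htheta).
    now rewrite (hom_eval (theta' := thetaN) hh (fun s x => eq_refl)). }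
  exists (ctx_eval c (eval theta (tr_lhs tr))), (ctx_eval c (eval theta (tr_rhs tr))).
  repeat split; auto.
  (* Level 0 suffices, as the conditions contain no transitions. *)
  exists 0; constructor; auto.
  - intros s t t' hin; exact (hsat _ hin).
  - intros s t t' hin; destruct (hsat _ hin).
Qed.
End Lift.

Theorem corollary5p6 (Sg : poa_signature) (B B' N : algebra Sg)
    (q : forall s, B s -> B' s) (h : forall s, B' s -> N s)
    (incl : forall s, N s -> B s)
    (hq : is_hom q) (hh : is_hom h)
    (hbeta : nf_hom incl (fun s (b : B s) => h s (q s b)))
    (Gamma : transition Sg -> Prop)
    (hcoh : coherent Gamma incl (fun s (b : B s) => h s (q s b)))
    (hcond : constant_conditions Gamma incl)
    (hjunk : forall s, condition_sort Gamma s -> no_junk incl s)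
    (hconf : forall s, condition_sort Gamma s -> no_confusion incl s) :
  is_poa_hom
    (on_sys (star (rew Gamma (B := B'))))
    (on_sys (star (rew_nf Gamma incl (fun s (b : B s) => h s (q s b)))))
    h.
Proof.
  repeat split; auto.
  - intros x; apply rt_refl.
  - intros x y z; apply rt_trans.
  - intros x; apply rt_refl.
  - intros x y z; apply rt_trans.
  - unfold on_sys, star; intros s x y hxy.
    induction hxy as [x y hxy | x | x y z _ IH1 _ IH2].
    + destruct (rew_lift hh hbeta Gamma hcond hjunk hxy) as (a1 & a2 & ha & <- & <-).
      exact (hcoh _ _ _ ha).
    + apply rt_refl.
    + eapply rt_trans; eassumption.
Qed.
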